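(* Let $(\mathcal M,\lozenge,\Psi,u)$ be a $\mathcal C$-actegory. A monad $\tilde{\mathbf T}=(\tilde T,\mu,\eta)$, $\tilde T=(T,\zeta)$, on $\mathcal M$ in the strict 2-category $\mathcal C\mathbf{-act}^c$ is the same as a usual monad $\mathbf T=(T,\mu,\eta)$ on the category $\mathcal M$ together with a binatural transformation $\zeta: T(\_\lozenge\_)\Rightarrow \_\lozenge T(\_)$ of bifunctors $\mathcal C\times\mathcal M\to\mathcal M$ satisfying, for all $A,B,C\in\mathrm{Ob}\,\mathcal C$ and $M\in\mathrm{Ob}\,\mathcal M$, \begin{align*} &u_{TM}\circ\zeta_{\mathbf 1,M}=T(u_M),\\ &\Psi_{A,B,TM}\circ\zeta_{A\otimes B,M}=(A\lozenge\zeta_{B,M})\circ\zeta_{A,B\lozenge M}\circ T(\Psi_{A,B,M}),\\ &\zeta_{C,M}\circ\mu_{C\lozenge M}=(C\lozenge\mu_M)\circ\zeta_{C,TM}\circ T(\zeta_{C,M}),\\ &\zeta_{C,M}\circ\eta_{C\lozenge M}=C\lozenge\eta_M . \end{align*} That is, the assignment $((T,\zeta),\mu,\eta)\mapsto((T,\mu,\eta),\zeta)$ is a bijection between monads on $\mathcal M$ in $\mathcal C\mathbf{-act}^c$ and such pairs $(\mathbf T,\zeta)$.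
   Context: $\mathcal C$ is a fixed monoidal category with product $\otimes$, unit $\mathbf 1$, associativity isomorphisms $a_{X,Y,Z}:X\otimes(Y\otimes Z)\to(X\otimes Y)\otimes Z$ and unit isomorphisms $l_A:\mathbf 1\otimes A\to A$, $r_A:A\otimes\mathbf 1\to A$, satisfying the usual coherences. A $\mathcal C$-actegory is a category $\mathcal N$ with a bifunctor $\lozenge:\mathcal C\times\mathcal N\to\mathcal N$ and natural isomorphisms $\Psi_{Q,Q',N}:(Q\otimes Q')\lozenge N\to Q\lozenge(Q'\lozenge N)$, $u_N:\mathbf 1\lozenge N\to N$ such that $\Psi_{Q,Q',Q''\lozenge N}\circ\Psi_{Q\otimes Q',Q'',N}\circ(a_{Q,Q',Q''}\lozenge N)=(Q\lozenge\Psi_{Q',Q'',N})\circ\Psi_{Q,Q'\otimes Q'',N}$, $u_{Q\lozenge N}\circ\Psi_{\mathbf 1,Q,N}=l_Q\lozenge N$ and $(Q\lozenge u_N)\circ\Psi_{Q,\mathbf 1,N}=r_Q\lozenge N$. A colax $\mathcal C$-equivariant functor $(F,\zeta):\mathcal M\to\mathcal N$ of $\mathcal C$-actegories is a functor $F$ with a binatural transformation $\zeta_{C,M}:F(C\lozenge M)\to C\lozenge F(M)$ such that $u_{F(M)}\circ\zeta_{\mathbf 1,M}=F(u_M)$ and $\Psi_{A,B,F(M)}\circ\zeta_{A\otimes B,M}=(A\lozenge\zeta_{B,M})\circ\zeta_{A,B\lozenge M}\circ F(\Psi_{A,B,M})$. Composition: $(F,\zeta^F)\circ(G,\zeta^G)=(F\circ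 G,\zeta^{F\circ G})$ with $\zeta^{F\circ G}_{C,M}=\zeta^F_{C,GM}\circ F(\zeta^G_{C,M})$. A $\mathcal C$-equivariant natural transformation $\alpha:(F,\zeta^F)\Rightarrow(G,\zeta^G)$ is a natural transformation $\alpha:F\Rightarrow G$ with $(C\lozenge\alpha_M)\circ\zeta^F_{C,M}=\zeta^G_{C,M}\circ\alpha_{C\lozenge M}$ for all $C,M$. The strict 2-category $\mathcal C\mathbf{-act}^c$ has $\mathcal C$-actegories as objects, colax $\mathcal C$-equivariant functors as 1-cells, $\mathcal C$-equivariant natural transformations as 2-cells, with the usual compositions of natural transformations. The identity 1-cell is $(\mathrm{Id},\mathrm{id})$. A monad in a 2-category on an object is a monoid in the monoidal category of endo-1-cells of that object. *)

(* Defs.v *)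
From Stdlib Require Import FunctionalExtensionality ProofIrrelevance.
From Corelib Require Export ssreflect ssrfun.

Set Implicit Arguments.
Unset Strict Implicit.
Unset Printing Implicit Defensive.

Declare Scope cat_scope.
Delimit Scope cat_scope with cat.
Open Scope cat_scope.

Record Category := {
  ob :> Type;
  hom : ob -> ob -> Type;
  idm : forall x, hom x x;
  comp : forall x y z, hom y z -> hom x y -> hom x z;
  comp_idl : forall x y (f : hom x y), comp (idm y) f = f;
  comp_idr : forall x y (f : hom x y), comp f (idm x) = f;
  comp_assoc : forall w x y z (h : hom y z) (g : hom x y) (f : hom w x),
    comp h (comp g f) = comp (comp h g) f
}.
Arguments idm {c} x.
Arguments comp {c x y z} g f.

Notation "g ∘ f" := (comp g f) (at level 40, left associativity) : cat_scope.

Definition is_iso (C : Category) (x y : C) (f : hom x y) : Prop :=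
  exists g : hom y x, g ∘ f = idm x /\ f ∘ g = idm y.

Record Functor (C D : Category) := {
  fob :> C -> D;
  fmap : forall x y, hom x y -> hom (fob x) (fob y);
  fmap_id : forall x, fmap (idm x) = idm (fob x);
  fmap_comp : forall x y z (g : hom y z) (f : hom x y),
    fmap (g ∘ f) = fmap g ∘ fmap f
}.
Arguments fmap {C D} f {x y} _ : rename.

Record NatTrans (C D : Category) (F G : Functor C D) := {
  component :> forall x, hom (F x) (G x);
  naturality : forall x y (f : hom x y),
    component y ∘ fmap F f = fmap G f ∘ component x
}.

Definition is_nat_iso (C D : Category) (F G : Functor C D)
  (alpha : NatTrans F G) : Prop := forall x, is_iso (alpha x).

Lemma nat_trans_eq (C D : Category) (F G : Functor C D) (a b : NatTrans F G) :
  (forall x, a x = b x) -> a = b.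
Proof.
case: a b => [a Ha] [b Hb] /= E.
have e : a = b by apply: functional_extensionality_dep.
by subst b; rewrite (proof_irrelevance _ Ha Hb).
Qed.

Definition id_functor (C : Category) : Functor C C.
Proof.
by refine {| fob := fun x : C => x; fmap := fun x y f => f |}.
Defined.

Definition comp_functor (C D E : Category) (G : Functor D E) (F : Functor C D) :
  Functor C E.
Proof.
refine {| fob := fun x => G (F x); fmap := fun x y f => fmap G (fmap F f) |}.
- abstract (by move=> x; rewrite !fmap_id).
- abstract (by move=> x y z g f; rewrite !fmap_comp).
Defined.

Notation "G ∘F F" := (comp_functor G F) (at level 40, left associativity) : cat_scope.

Definition id_trans (C D : Category) (F : Functor C D) : NatTrans F F.
Proof.
refine {| component := fun x => idm (F x) |}.
abstract (by move=> x y f; rewrite comp_idl comp_idr).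
Defined.

Definition comp_trans (C D : Category) (F G H : Functor C D)
  (b : NatTrans G H) (a : NatTrans F G) : NatTrans F H.
Proof.
refine {| component := fun x => b x ∘ a x |}.
abstract (by move=> x y f; rewrite -comp_assoc naturality comp_assoc naturality comp_assoc).
Defined.

Definition hcomp_trans (C D E : Category) (G G' : Functor D E) (F F' : Functor C D)
  (b : NatTrans G G') (a : NatTrans F F') : NatTrans (G ∘F F) (G' ∘F F').
Proof.
refine {| component := fun x => b (F' x) ∘ fmap G (a x) : hom ((G ∘F F) x) ((G' ∘F F') x) |}.
abstract (move=> x y f /=;
    by rewrite -comp_assoc -fmap_comp (naturality a) fmap_comp !comp_assoc naturality).
Defined.

Definition prod_cat (C D : Category) : Category.
Proof.
refine {|
  ob := (C * D)%type;
  hom := fun p q => (hom (fst p) (fst q) * hom (snd p) (snd q))%type;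
  idm := fun p => (idm (fst p), idm (snd p));
  comp := fun p q r g f => (fst g ∘ fst f, snd g ∘ snd f)
|}.
- abstract (by move=> x y [f1 f2]; rewrite /= !comp_idl).
- abstract (by move=> x y [f1 f2]; rewrite /= !comp_idr).
- abstract (by move=> w x y z h g f; rewrite /= !comp_assoc).
Defined.

Notation "C ×C D" := (prod_cat C D) (at level 40, left associativity) : cat_scope.

Definition prod_functor (C C' D D' : Category) (F : Functor C C') (G : Functor D D') :
  Functor (C ×C D) (C' ×C D').
Proof.
refine {|
  fob := fun p : C ×C D => (F (fst p), G (snd p)) : C' ×C D';
  fmap := fun p q f => (fmap F (fst f), fmap G (snd f))
|}.
- abstract (by move=> p; rewrite /= !fmap_id).
- abstract (by move=> p q r g f; rewrite /= !fmap_comp).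
Defined.

Notation "F ×F G" := (prod_functor F G) (at level 40, left associativity) : cat_scope.

Definition prod_assoc_functor (C D E : Category) :
  Functor (C ×C (D ×C E)) ((C ×C D) ×C E).
Proof.
by refine {|
  fob := fun p : C ×C (D ×C E) =>
    ((fst p, fst (snd p)), snd (snd p)) : (C ×C D) ×C E;
  fmap := fun p q f => ((fst f, fst (snd f)), snd (snd f))
|}.
Defined.

Definition bimap (C D E : Category) (B : Functor (C ×C D) E) (x x' : C) (y y' : D)
  (f : hom x x') (g : hom y y') : hom (B (x, y)) (B (x', y')) :=
  @fmap (C ×C D) E B (x, y) (x', y') (f, g).

Definition fix_left (C D E : Category) (B : Functor (C ×C D) E) (c : C) : Functor D E.
Proof.
refine {| fob := fun y => B (c, y); fmap := fun y y' g => bimap B (idm c) g |}.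
- abstract (by move=> y; exact: (@fmap_id _ _ B (c, y))).
- abstract (move=> x y z g f; rewrite /bimap -fmap_comp;
    by rewrite /= comp_idl).
Defined.

Definition fix_right (C D E : Category) (B : Functor (C ×C D) E) (d : D) : Functor C E.
Proof.
refine {| fob := fun x => B (x, d); fmap := fun x x' f => bimap B f (idm d) |}.
- abstract (by move=> x; exact: (@fmap_id _ _ B (x, d))).
- abstract (move=> x y z g f; rewrite /bimap -fmap_comp;
    by rewrite /= comp_idl).
Defined.

Record MonoidalCategory := {
  mcat :> Category;
  tens : Functor (mcat ×C mcat) mcat;
  unit_ob : mcat;
  massoc : NatTrans (tens ∘F (id_functor mcat ×F tens))
                    (tens ∘F (tens ×F id_functor mcat) ∘F prod_assoc_functor mcat mcat mcat);
  munitl : NatTrans (fix_left tens unit_ob) (id_functor mcat);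
  munitr : NatTrans (fix_right tens unit_ob) (id_functor mcat);
  massoc_iso : is_nat_iso massoc;
  munitl_iso : is_nat_iso munitl;
  munitr_iso : is_nat_iso munitr;
  mpentagon : forall W X Y Z : mcat,
    massoc (tens (W, X), (Y, Z)) ∘ massoc (W, (X, tens (Y, Z)))
    = bimap tens (massoc (W, (X, Y))) (idm Z)
      ∘ massoc (W, (tens (X, Y), Z))
      ∘ bimap tens (idm W) (massoc (X, (Y, Z)));
  mtriangle : forall X Y : mcat,
    bimap tens (munitr X) (idm Y) ∘ massoc (X, (unit_ob, Y))
    = bimap tens (idm X) (munitl Y)
}.
Arguments tens {m}.
Arguments unit_ob {m}.
Arguments massoc {m}.
Arguments munitl {m}.
Arguments munitr {m}.

Notation "X ⊗ Y" := (tens (X, Y)) (at level 35, right associativity) : cat_scope.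
Notation "f ⊗m g" := (bimap tens f g) (at level 35, right associativity) : cat_scope.

Record MonoidData (C : MonoidalCategory) := {
  mon_ob : C;
  mon_mul : hom (mon_ob ⊗ mon_ob) mon_ob;
  mon_unit : hom unit_ob mon_ob
}.

Record IsMonoid (C : MonoidalCategory) (A : MonoidData C) : Prop := {
  mon_mulA : mon_mul A ∘ (mon_mul A ⊗m idm (mon_ob A)) ∘ massoc (mon_ob A, (mon_ob A, mon_ob A))
             = mon_mul A ∘ (idm (mon_ob A) ⊗m mon_mul A);
  mon_mul1l : mon_mul A ∘ (mon_unit A ⊗m idm (mon_ob A)) = munitl (mon_ob A);
  mon_mul1r : mon_mul A ∘ (idm (mon_ob A) ⊗m mon_unit A) = munitr (mon_ob A)
}.

Record Monoid (C : MonoidalCategory) := {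
  mon_data :> MonoidData C;
  mon_ax : IsMonoid mon_data
}.

(* The identity of [x], seen as a morphism along an equality of objects.
   Composition of 1-cells in a strict 2-category is associative and unital up to
   Leibniz equality; [eq_hom] makes the corresponding equations between 2-cells
   well-typed, and gives the coherence isomorphisms of [endo_monoidal]. *)
Definition eq_hom (C : Category) (x y : C) (e : x = y) : hom x y :=
  match e in _ = z return hom x z with eq_refl => idm x end.

Record Strict2Category := {
  cell0 :> Type;
  Hom : cell0 -> cell0 -> Category;
  id1 : forall X, Hom X X;
  hcomp : forall X Y Z, Functor (Hom Y Z ×C Hom X Y) (Hom X Z);
  hcompA : forall W X Y Z (h : Hom Y Z) (g : Hom X Y) (f : Hom W X),
    hcomp _ _ _ (h, hcomp _ _ _ (g, f)) = hcomp _ _ _ (hcomp _ _ _ (h, g), f);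
  hcomp1l : forall X Y (f : Hom X Y), hcomp _ _ _ (id1 Y, f) = f;
  hcomp1r : forall X Y (f : Hom X Y), hcomp _ _ _ (f, id1 X) = f;
  hcompA2 : forall W X Y Z (h h' : Hom Y Z) (g g' : Hom X Y) (f f' : Hom W X)
      (c : hom h h') (b : hom g g') (a : hom f f'),
    eq_hom (hcompA h' g' f') ∘ bimap (hcomp _ _ _) c (bimap (hcomp _ _ _) b a)
    = bimap (hcomp _ _ _) (bimap (hcomp _ _ _) c b) a ∘ eq_hom (hcompA h g f);
  hcomp1l2 : forall X Y (f f' : Hom X Y) (a : hom f f'),
    eq_hom (hcomp1l f') ∘ bimap (hcomp _ _ _) (idm (id1 Y)) a = a ∘ eq_hom (hcomp1l f);
  hcomp1r2 : forall X Y (f f' : Hom X Y) (a : hom f f'),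
    eq_hom (hcomp1r f') ∘ bimap (hcomp _ _ _) a (idm (id1 X)) = a ∘ eq_hom (hcomp1r f)
}.
Arguments Hom {s} _ _.
Arguments id1 {s} X.
Arguments hcomp {s X Y Z}.
Arguments hcompA {s W X Y Z} h g f.
Arguments hcomp1l {s X Y} f.
Arguments hcomp1r {s X Y} f.

Lemma eq_hom_iso (C : Category) (x y : C) (e : x = y) : is_iso (eq_hom e).
Proof.
by case: y / e; exists (idm x); rewrite /= comp_idl.
Qed.

Lemma eq_hom_refl (C : Category) (x : C) (e : x = x) : eq_hom e = idm x.
Proof. by rewrite (proof_irrelevance _ e eq_refl). Qed.

Lemma eq_hom_comp (C : Category) (x y z : C) (e : x = y) (e' : y = z) :
  eq_hom e' ∘ eq_hom e = eq_hom (eq_trans e e').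
Proof. by case: z / e'; case: y / e; rewrite /= comp_idl. Qed.

Lemma bimap_eq_hom_l (C D E : Category) (B : Functor (C ×C D) E) (x x' : C) (y : D)
  (e : x = x') :
  bimap B (eq_hom e) (idm y) = eq_hom (f_equal (fun z => B (z, y)) e).
Proof. by case: x' / e; exact: (@fmap_id _ _ B (x, y)). Qed.

Lemma bimap_eq_hom_r (C D E : Category) (B : Functor (C ×C D) E) (x : C) (y y' : D)
  (e : y = y') :
  bimap B (idm x) (eq_hom e) = eq_hom (f_equal (fun z => B (x, z)) e).
Proof. by case: y' / e; exact: (@fmap_id _ _ B (x, y)). Qed.

Section Endo.
Variables (K : Strict2Category) (X : K).
Let E := Hom X X.
Let m : Functor (E ×C E) E := hcomp.

Definition endo_assoc :
  NatTrans (m ∘F (id_functor E ×F m)) (m ∘F (m ×F id_functor E) ∘F prod_assoc_functor E E E).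
Proof.
refine (@Build_NatTrans _ _ (m ∘F (id_functor E ×F m))
  (m ∘F (m ×F id_functor E) ∘F prod_assoc_functor E E E)
  (fun '(h, (g, f)) => eq_hom (hcompA h g f)) _).
abstract (by move=> [h [g f]] [h' [g' f']] [c [b a]]; exact: hcompA2).
Defined.

Definition endo_unitl : NatTrans (fix_left m (id1 X)) (id_functor E).
Proof.
refine (@Build_NatTrans _ _ (fix_left m (id1 X)) (id_functor E)
  (fun f => eq_hom (hcomp1l f)) _).
abstract (by move=> f f' a; exact: hcomp1l2).
Defined.

Definition endo_unitr : NatTrans (fix_right m (id1 X)) (id_functor E).
Proof.
refine (@Build_NatTrans _ _ (fix_right m (id1 X)) (id_functor E)
  (fun f => eq_hom (hcomp1r f)) _).
abstract (by move=> f f' a; exact: hcomp1r2).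
Defined.

Definition endo_monoidal : MonoidalCategory.
Proof.
refine {|
  mcat := E;
  tens := m;
  unit_ob := id1 X;
  massoc := endo_assoc;
  munitl := endo_unitl;
  munitr := endo_unitr
|}.
- abstract (by move=> [h [g f]]; exact: eq_hom_iso).
- abstract (by move=> p; exact: eq_hom_iso).
- abstract (by move=> p; exact: eq_hom_iso).
- abstract (move=> W Y Z V /=; rewrite bimap_eq_hom_l bimap_eq_hom_r !eq_hom_comp;
    by congr eq_hom; exact: proof_irrelevance).
- abstract (move=> Y Z /=; rewrite bimap_eq_hom_l bimap_eq_hom_r eq_hom_comp;
    by congr eq_hom; exact: proof_irrelevance).
Defined.

End Endo.

Definition MonadIn (K : Strict2Category) (X : K) : Type := Monoid (endo_monoidal X).

Record Actegory (C : MonoidalCategory) := {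
  acat :> Category;
  act : Functor (C ×C acat) acat;
  aassoc : NatTrans (act ∘F (tens ×F id_functor acat) ∘F prod_assoc_functor C C acat)
                    (act ∘F (id_functor C ×F act));
  aunit : NatTrans (fix_left act unit_ob) (id_functor acat);
  aassoc_iso : is_nat_iso aassoc;
  aunit_iso : is_nat_iso aunit;
  apentagon : forall (Q Q' Q'' : C) (N : acat),
    aassoc (Q, (Q', act (Q'', N))) ∘ aassoc (Q ⊗ Q', (Q'', N))
      ∘ bimap act (massoc (Q, (Q', Q''))) (idm N)
    = bimap act (idm Q) (aassoc (Q', (Q'', N))) ∘ aassoc (Q, (Q' ⊗ Q'', N));
  aunitl : forall (Q : C) (N : acat),
    aunit (act (Q, N)) ∘ aassoc (unit_ob, (Q, N)) = bimap act (munitl Q) (idm N);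
  aunitr : forall (Q : C) (N : acat),
    bimap act (idm Q) (aunit N) ∘ aassoc (Q, (unit_ob, N)) = bimap act (munitr Q) (idm N)
}.
Arguments act {C a}.
Arguments aassoc {C a}.
Arguments aunit {C a}.

Notation "Q ◊ N" := (act (Q, N)) (at level 35, right associativity) : cat_scope.
Notation "Q ◊m f" := (bimap act (idm Q) f) (at level 35, right associativity) : cat_scope.

(* The components of [z : Binatural F] have type F (C ◊ M) -> C ◊ F M. *)
Definition Binatural (C : MonoidalCategory) (M N : Actegory C) (F : Functor M N) : Type :=
  NatTrans (F ∘F @act C M) (@act C N ∘F (id_functor C ×F F)).

Record IsColax (C : MonoidalCategory) (M N : Actegory C) (F : Functor M N)
  (z : Binatural F) : Prop := {
  colax_unit : forall X : M,
    aunit (F X) ∘ z (unit_ob, X) = fmap F (aunit X);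
  colax_assoc : forall (A B : C) (X : M),
    aassoc (A, (B, F X)) ∘ z (A ⊗ B, X)
    = (A ◊m z (B, X)) ∘ z (A, B ◊ X) ∘ fmap F (aassoc (A, (B, X)))
}.

Record ColaxFunctor (C : MonoidalCategory) (M N : Actegory C) := {
  colax_functor :> Functor M N;
  colax_zeta : Binatural colax_functor;
  colax_ax : IsColax colax_zeta
}.

Record EquivTrans (C : MonoidalCategory) (M N : Actegory C) (F G : ColaxFunctor M N) := {
  equiv_trans :> NatTrans F G;
  equivariance : forall (A : C) (X : M),
    (A ◊m equiv_trans X) ∘ colax_zeta F (A, X) = colax_zeta G (A, X) ∘ equiv_trans (A ◊ X)
}.

Lemma equiv_trans_eq (C : MonoidalCategory) (M N : Actegory C) (F G : ColaxFunctor M N)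
  (a b : EquivTrans F G) : (forall x, a x = b x) -> a = b.
Proof.
case: a b => [a Ha] [b Hb] /= E.
have e : a = b by apply: nat_trans_eq.
by subst b; rewrite (proof_irrelevance _ Ha Hb).
Qed.

Section Bimap.
Variables (C D E : Category) (B : Functor (C ×C D) E).

Lemma bimap_id (x : C) (y : D) : bimap B (idm x) (idm y) = idm (B (x, y)).
Proof. exact: (@fmap_id _ _ B (x, y)). Qed.

Lemma bimap_comp (x x' x'' : C) (y y' y'' : D) (f' : hom x' x'') (f : hom x x')
  (g' : hom y' y'') (g : hom y y') :
  bimap B f' g' ∘ bimap B f g = bimap B (f' ∘ f) (g' ∘ g).
Proof. by rewrite /bimap -fmap_comp. Qed.

Lemma bimap_comp_r (x : C) (y y' y'' : D) (g' : hom y' y'') (g : hom y y') :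
  bimap B (idm x) (g' ∘ g) = bimap B (idm x) g' ∘ bimap B (idm x) g.
Proof. by rewrite bimap_comp comp_idl. Qed.

End Bimap.

Section ActColax.
Variable C : MonoidalCategory.

Lemma binatural_bimap (M N : Actegory C) (F : Functor M N) (z : Binatural F)
  (A A' : C) (X X' : M) (f : hom A A') (g : hom X X') :
  z (A', X') ∘ fmap F (bimap act f g) = bimap act f (fmap F g) ∘ z (A, X).
Proof. exact: (@naturality _ _ _ _ z (A, X) (A', X') (f, g)). Qed.

Definition id_zeta (M : Actegory C) : Binatural (id_functor M).
Proof.
refine (@Build_NatTrans _ _ (id_functor M ∘F act) (act ∘F (id_functor C ×F id_functor M))
  (fun '(A, X) => idm (A ◊ X)) _).
abstract (by move=> [A X] [A' X'] [f g] /=; rewrite comp_idl comp_idr).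
Defined.

Lemma id_zeta_colax (M : Actegory C) : IsColax (id_zeta M).
Proof.
split=> /=.
- by move=> X; rewrite comp_idr.
- by move=> A B X; rewrite bimap_id comp_idr !comp_idl.
Qed.

Definition id_colax (M : Actegory C) : ColaxFunctor M M :=
  {| colax_functor := id_functor M; colax_zeta := id_zeta M; colax_ax := id_zeta_colax M |}.

Definition comp_zeta (M N P : Actegory C) (F : ColaxFunctor N P) (G : ColaxFunctor M N) :
  Binatural (F ∘F G).
Proof.
refine (@Build_NatTrans _ _ (F ∘F G ∘F act) (act ∘F (id_functor C ×F (F ∘F G)))
  (fun p => colax_zeta F (fst p, G (snd p)) ∘ fmap F (colax_zeta G p)) _).
abstract (move=> [A X] [A' X'] [f g] /=;
    rewrite -comp_assoc -fmap_comp;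
    rewrite (binatural_bimap (colax_zeta G) f g) fmap_comp comp_assoc;
    by rewrite (binatural_bimap (colax_zeta F) f (fmap G g)) comp_assoc).
Defined.

Lemma comp_zeta_colax (M N P : Actegory C) (F : ColaxFunctor N P) (G : ColaxFunctor M N) :
  IsColax (comp_zeta F G).
Proof.
split=> /=.
- by move=> X; rewrite comp_assoc (colax_unit (colax_ax F)) -fmap_comp (colax_unit (colax_ax G)).
- move=> A B X.
  rewrite comp_assoc (colax_assoc (colax_ax F)) -[LHS]comp_assoc -fmap_comp.
  rewrite (colax_assoc (colax_ax G)) !fmap_comp bimap_comp_r !comp_assoc.
  rewrite -(comp_assoc _ _ (fmap F (bimap _ _ _))).
  by rewrite (binatural_bimap (colax_zeta F)) !comp_assoc.
Qed.

Definition comp_colax (M N P : Actegory C) (F : ColaxFunctor N P) (G : ColaxFunctor M N) :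
  ColaxFunctor M P :=
  {| colax_functor := F ∘F G; colax_zeta := comp_zeta F G; colax_ax := comp_zeta_colax F G |}.

Definition colax_cat (M N : Actegory C) : Category.
Proof.
unshelve refine {|
  ob := ColaxFunctor M N;
  hom := @EquivTrans C M N;
  idm := fun F => {| equiv_trans := id_trans F |};
  comp := fun F G H b a => {| equiv_trans := comp_trans b a |}
|}.
- abstract (by move=> A X /=; rewrite bimap_id comp_idl comp_idr).
- abstract (move=> A X /=;
    by rewrite bimap_comp_r -comp_assoc equivariance [LHS]comp_assoc equivariance comp_assoc).
- abstract (by move=> F G a; apply: equiv_trans_eq => X /=; rewrite comp_idl).
- abstract (by move=> F G a; apply: equiv_trans_eq => X /=; rewrite comp_idr).
- abstract (by move=> F G H K c b a; apply: equiv_trans_eq => X /=; rewrite comp_assoc).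
Defined.

Definition hcomp_equiv (M N P : Actegory C) (F F' : ColaxFunctor N P)
  (G G' : ColaxFunctor M N) (b : EquivTrans F F') (a : EquivTrans G G') :
  EquivTrans (comp_colax F G) (comp_colax F' G').
Proof.
refine (@Build_EquivTrans C M P (comp_colax F G) (comp_colax F' G') (hcomp_trans b a) _).
abstract (move=> A X /=;
    rewrite bimap_comp_r -[LHS]comp_assoc;
    rewrite [bimap _ _ (fmap F _) ∘ _]comp_assoc -binatural_bimap;
    rewrite -(comp_assoc _ (fmap F _) (fmap F _)) -fmap_comp equivariance fmap_comp !comp_assoc;
    by rewrite equivariance -(comp_assoc _ (fmap F' _) (b _)) -naturality !comp_assoc).
Defined.

Definition hcomp_colax (M N P : Actegory C) :
  Functor (colax_cat N P ×C colax_cat M N) (colax_cat M P).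
Proof.
refine (@Build_Functor (colax_cat N P ×C colax_cat M N) (colax_cat M P)
  (fun p => comp_colax (fst p) (snd p))
  (fun p q a => hcomp_equiv (fst a) (snd a)) _ _).
- abstract (by move=> [F G]; apply: equiv_trans_eq => X /=; rewrite fmap_id comp_idl).
- abstract (move=> [F G] [F' G'] [F'' G''] [b' a'] [b a]; apply: equiv_trans_eq => X /=;
    rewrite fmap_comp -!comp_assoc; congr (_ ∘ _); rewrite !comp_assoc;
    by rewrite naturality).
Defined.

Lemma colax_eq (M N : Actegory C) (fo : M -> N)
  (fm : forall x y : M, hom x y -> hom (fo x) (fo y))
  (p1 q1 : forall x, fm x x (idm x) = idm (fo x))
  (p2 q2 : forall x y z (g : hom y z) (f : hom x y), fm x z (g ∘ f) = fm y z g ∘ fm x y f)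
  (z : Binatural (Build_Functor p1 p2)) (w : Binatural (Build_Functor q1 q2))
  (Hz : IsColax z) (Hw : IsColax w) :
  (forall (A : C) (X : M), z (A, X) = w (A, X)) ->
  Build_ColaxFunctor Hz = Build_ColaxFunctor Hw.
Proof.
move=> E; have e1 := proof_irrelevance _ p1 q1; have e2 := proof_irrelevance _ p2 q2.
subst q1 q2; have e : z = w by apply: nat_trans_eq => -[A X]; exact: E.
by subst w; rewrite (proof_irrelevance _ Hz Hw).
Qed.

Lemma eq_hom_colax (M N : Actegory C) (F G : colax_cat M N) (e : F = G) (X : M) :
  equiv_trans (eq_hom e) X = eq_hom (f_equal (fun H : colax_cat M N => H X) e).
Proof. by case: G / e. Qed.

Lemma comp_colaxA (M N P Q : Actegory C) (H : ColaxFunctor P Q) (G : ColaxFunctor N P)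
  (F : ColaxFunctor M N) :
  comp_colax H (comp_colax G F) = comp_colax (comp_colax H G) F.
Proof. by apply: colax_eq => A X /=; rewrite fmap_comp comp_assoc. Qed.

Lemma comp_colax1l (M N : Actegory C) (F : ColaxFunctor M N) :
  comp_colax (id_colax N) F = F.
Proof.
case: F => [[fo fm p1 p2] z Hz]; apply: colax_eq => A X /=.
exact: comp_idl.
Qed.

Lemma comp_colax1r (M N : Actegory C) (F : ColaxFunctor M N) :
  comp_colax F (id_colax M) = F.
Proof.
case: F => [[fo fm p1 p2] z Hz]; apply: colax_eq => A X /=.
by rewrite p1 comp_idr.
Qed.

Definition act_colax : Strict2Category.
Proof.
refine (@Build_Strict2Category (Actegory C) colax_cat id_colax hcomp_colax
  comp_colaxA comp_colax1l comp_colax1r _ _ _).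
- abstract (move=> W X Y Z h h' g g' f f' c b a; apply: equiv_trans_eq => x /=;
    rewrite !eq_hom_colax !eq_hom_refl comp_idl comp_idr /=;
    by rewrite fmap_comp comp_assoc).
- abstract (move=> X Y f f' a; apply: equiv_trans_eq => x /=;
    by rewrite !eq_hom_colax !eq_hom_refl comp_idl comp_idr /= comp_idl).
- abstract (move=> X Y f f' a; apply: equiv_trans_eq => x /=;
    by rewrite !eq_hom_colax !eq_hom_refl comp_idl comp_idr /= fmap_id comp_idr).
Defined.

End ActColax.

Record MonadData (M : Category) := {
  md_functor : Functor M M;
  md_mul : NatTrans (md_functor ∘F md_functor) md_functor;
  md_unit : NatTrans (id_functor M) md_functor
}.

Record IsMonad (M : Category) (T : MonadData M) : Prop := {
  monad_mulA : forall X : M,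
    md_mul T X ∘ fmap (md_functor T) (md_mul T X)
    = md_mul T X ∘ md_mul T (md_functor T X);
  monad_mul1l : forall X : M, md_mul T X ∘ md_unit T (md_functor T X) = idm (md_functor T X);
  monad_mul1r : forall X : M,
    md_mul T X ∘ fmap (md_functor T) (md_unit T X) = idm (md_functor T X)
}.

Record DistributiveData (C : MonoidalCategory) (M : Actegory C) := {
  dd_monad : MonadData M;
  dd_zeta : Binatural (md_functor dd_monad)
}.

Record IsDistributive (C : MonoidalCategory) (M : Actegory C) (D : DistributiveData M) : Prop := {
  dist_monad : IsMonad (dd_monad D);
  dist_act_unit : forall X : M,
    aunit (md_functor (dd_monad D) X) ∘ dd_zeta D (unit_ob, X)
    = fmap (md_functor (dd_monad D)) (aunit X);
  dist_act_assoc : forall (A B : C) (X : M),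
    aassoc (A, (B, md_functor (dd_monad D) X)) ∘ dd_zeta D (A ⊗ B, X)
    = (A ◊m dd_zeta D (B, X)) ∘ dd_zeta D (A, B ◊ X)
      ∘ fmap (md_functor (dd_monad D)) (aassoc (A, (B, X)));
  dist_mul : forall (A : C) (X : M),
    dd_zeta D (A, X) ∘ md_mul (dd_monad D) (A ◊ X)
    = (A ◊m md_mul (dd_monad D) X) ∘ dd_zeta D (A, md_functor (dd_monad D) X)
      ∘ fmap (md_functor (dd_monad D)) (dd_zeta D (A, X));
  dist_unit : forall (A : C) (X : M),
    dd_zeta D (A, X) ∘ md_unit (dd_monad D) (A ◊ X) = A ◊m md_unit (dd_monad D) X
}.

Record DistributiveMonad (C : MonoidalCategory) (M : Actegory C) := {
  dm_data :> DistributiveData M;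
  dm_ax : IsDistributive dm_data
}.

(* ((T, zeta), mu, eta) |-> ((T, mu, eta), zeta). *)
Definition underlying_data (C : MonoidalCategory) (M : act_colax C)
  (T : MonoidData (endo_monoidal M)) : @DistributiveData C M :=
  let F : @ColaxFunctor C M M := mon_ob T in
  let mu : EquivTrans (comp_colax F F) F := mon_mul T in
  let eta : EquivTrans (id_colax M) F := mon_unit T in
  {| dd_monad := {| md_functor := F; md_mul := mu; md_unit := eta |};
     dd_zeta := colax_zeta F |}.

(* Main.v *)
Require Import Defs.
From Stdlib Require Import ProofIrrelevance.

Set Implicit Arguments.
Unset Strict Implicit.
Unset Printing Implicit Defensive.

(** Both notions consist of the same data [T], [zeta], [mu], [eta]; they differ
    only in how the axioms are bundled.  In [act_colax C] the two action axioms
    say that [(T, zeta)] is a 1-cell, the compatibilities of [zeta] with [mu] and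
    [eta] say that [mu] and [eta] are 2-cells out of [(T, zeta) ∘ (T, zeta)] and
    of the identity 1-cell, and the remaining axioms are the monoid axioms.

    Only the last point needs an argument.  An equation of 2-cells holds as soon
    as it holds componentwise, and the coherence isomorphisms of the monoidal
    category of endo-1-cells are the 2-cells [eq_hom e] along a Leibniz equality
    [e] of 1-cells.  Although [e] is not given by reflexivity, the object parts of its two
    sides agree by computation, so the components of [eq_hom e] are identities
    ([eq_hom_colax_irrelevance]), and the monoid axioms become the usual monad axioms
    ([monoid_monad_iff]).  Rebundling the axioms ([monoid_data_of_distributive])
    is then inverse to [underlying_data], by proof irrelevance. *)

Section MonadsInActegories.
Variables (C : MonoidalCategory) (M : Actegory C).

(** The equality of objects that [e] induces at [X] may be replaced by any other
    one, in particular by reflexivity when [F X] and [G X] compute to the same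
    object.  The next three lemmas do so for associativity and the unit laws. *)
Lemma eq_hom_colax_irrelevance (N P : Actegory C) (F G : colax_cat N P) (e : F = G) (X : N)
  (e' : colax_functor F X = colax_functor G X) :
  equiv_trans (eq_hom e) X = eq_hom e'.
Proof. by rewrite eq_hom_colax; congr eq_hom; exact: proof_irrelevance. Qed.

Lemma eq_hom_comp_colaxA (N P Q : Actegory C) (H : ColaxFunctor P Q)
  (G : ColaxFunctor N P) (F : ColaxFunctor M N) (X : M) :
  equiv_trans (@eq_hom (colax_cat M Q) _ _ (comp_colaxA H G F)) X = idm (H (G (F X))).
Proof. exact: (@eq_hom_colax_irrelevance M Q _ _ (comp_colaxA H G F) X eq_refl). Qed.

Lemma eq_hom_comp_colax1l (N : Actegory C) (F : ColaxFunctor M N) (X : M) :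
  equiv_trans (@eq_hom (colax_cat M N) _ _ (comp_colax1l F)) X = idm (F X).
Proof. exact: (@eq_hom_colax_irrelevance M N _ _ (comp_colax1l F) X eq_refl). Qed.

Lemma eq_hom_comp_colax1r (N : Actegory C) (F : ColaxFunctor M N) (X : M) :
  equiv_trans (@eq_hom (colax_cat M N) _ _ (comp_colax1r F)) X = idm (F X).
Proof. exact: (@eq_hom_colax_irrelevance M N _ _ (comp_colax1r F) X eq_refl). Qed.

(** In components, whiskering [mu] or [eta] by [T] on one side applies [fmap T],
    and on the other side evaluates at [T X], up to composites with identities. *)
Lemma monoid_monad_iff (T : MonoidData (@endo_monoidal (act_colax C) M)) :
  IsMonoid T <-> IsMonad (dd_monad (underlying_data T)).
Proof.
case: T => F mu eta.
split=> -[HA Hl Hr]; split=> /=.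
- move=> X.
  have := f_equal (fun a : EquivTrans _ _ => a X) HA.
  rewrite /= eq_hom_comp_colaxA /=.
  by rewrite !fmap_id comp_idl !comp_idr.
- move=> X.
  have := f_equal (fun a : EquivTrans _ _ => a X) Hl.
  rewrite /= eq_hom_comp_colax1l /=.
  by rewrite comp_idr.
- move=> X.
  have := f_equal (fun a : EquivTrans _ _ => a X) Hr.
  rewrite /= eq_hom_comp_colax1r /=.
  by rewrite comp_idl.
- apply: equiv_trans_eq => X /=.
  rewrite eq_hom_comp_colaxA /=.
  rewrite !fmap_id comp_idl !comp_idr; by symmetry; exact: HA.
- apply: equiv_trans_eq => X /=.
  rewrite eq_hom_comp_colax1l /=.
  rewrite comp_idr; exact: Hl.
- apply: equiv_trans_eq => X /=.
  rewrite eq_hom_comp_colax1r /=.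
  rewrite comp_idl; exact: Hr.
Qed.

(** The four equations on [zeta] are already contained in the types of the
    1-cell and of the 2-cells of [T]. *)
Lemma underlying_distributive (T : MonoidData (@endo_monoidal (act_colax C) M)) :
  IsMonoid T -> IsDistributive (underlying_data T).
Proof.
move=> HT; split; first exact/monoid_monad_iff.
- exact: (colax_unit (colax_ax (mon_ob T))).
- exact: (colax_assoc (colax_ax (mon_ob T))).
- move=> A X; have /= := equivariance (mon_mul T) A X.
  by rewrite comp_assoc => ->.
- move=> A X; have /= := equivariance (mon_unit T) A X.
  by rewrite comp_idr => ->.
Qed.

Definition colax_of_distributive (D : DistributiveData M) (H : IsDistributive D) :
  ColaxFunctor M M :=
  {| colax_functor := md_functor (dd_monad D);
     colax_zeta := dd_zeta D;
     colax_ax := Build_IsColax (dist_act_unit H) (dist_act_assoc H) |}.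

Definition mul_of_distributive (D : DistributiveData M) (H : IsDistributive D) :
  EquivTrans (comp_colax (colax_of_distributive H) (colax_of_distributive H))
             (colax_of_distributive H).
Proof.
refine (@Build_EquivTrans C M M
  (comp_colax (colax_of_distributive H) (colax_of_distributive H))
  (colax_of_distributive H) (md_mul (dd_monad D)) _).
abstract (by move=> A X /=; rewrite (dist_mul H) comp_assoc).
Defined.

Definition unit_of_distributive (D : DistributiveData M) (H : IsDistributive D) :
  EquivTrans (id_colax M) (colax_of_distributive H).
Proof.
refine (@Build_EquivTrans C M M (id_colax M)
  (colax_of_distributive H) (md_unit (dd_monad D)) _).
abstract (by move=> A X /=; rewrite (dist_unit H) comp_idr).
Defined.

Definition monoid_data_of_distributive (D : DistributiveData M) (H : IsDistributive D) :
  MonoidData (@endo_monoidal (act_colax C) M) :=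
  @Build_MonoidData (@endo_monoidal (act_colax C) M)
    (colax_of_distributive H) (mul_of_distributive H) (unit_of_distributive H).

Lemma monoid_data_of_distributiveK (D : DistributiveData M) (H : IsDistributive D) :
  underlying_data (monoid_data_of_distributive H) = D.
Proof. by case: D H => [[T mu eta] zeta]. Qed.

(** Both sides have the same functor, [zeta], [mu] and [eta]; only the proofs
    that they form a 1-cell and 2-cells can differ. *)
Lemma underlying_dataK (T : MonoidData (@endo_monoidal (act_colax C) M))
  (H : IsDistributive (underlying_data T)) :
  monoid_data_of_distributive H = T.
Proof.
case: T H => -[F z Hz] [mu Hmu] [eta Heta] H.
rewrite /monoid_data_of_distributive /mul_of_distributive /unit_of_distributive.
move: (mul_of_distributive_subproof _) (unit_of_distributive_subproof _).
rewrite /colax_of_distributive /=.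
(* The types of [Hmu] and [Heta] mention [Hz], so the proofs that the functor is
   colax have to be identified before those of equivariance. *)
move: (Build_IsColax _ _) => Hz'.
have e := proof_irrelevance _ Hz Hz'; subst Hz'.
move=> Hmu' Heta'.
by rewrite (proof_irrelevance _ Hmu Hmu') (proof_irrelevance _ Heta Heta').
Qed.

Lemma monoid_of_distributive (D : DistributiveData M) (H : IsDistributive D) :
  IsMonoid (monoid_data_of_distributive H).
Proof.
apply/monoid_monad_iff; rewrite monoid_data_of_distributiveK; exact: dist_monad.
Qed.

End MonadsInActegories.

Theorem mainTheorem1 (C : MonoidalCategory) (M : Actegory C) :
  exists Phi : @MonadIn (act_colax C) M -> DistributiveMonad M,
    (forall T : @MonadIn (act_colax C) M, dm_data (Phi T) = underlying_data (mon_data T)) /\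
    bijective Phi.
Proof.
exists (fun T => Build_DistributiveMonad (underlying_distributive (mon_ax T))).
split=> //.
exists (fun D : DistributiveMonad M => Build_Monoid (monoid_of_distributive (dm_ax D))).
- case=> T HT /=.
  move: (monoid_of_distributive _); rewrite underlying_dataK => HT'.
  by rewrite (proof_irrelevance _ HT HT').
- case=> D HD /=.
  move: (underlying_distributive _); rewrite monoid_data_of_distributiveK => HD'.
  by rewrite (proof_irrelevance _ HD HD').
Qed.
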